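(* Let $\boldsymbol{\Sigma}=(\Sigma,\gamma,\mathscr{B})$ be a paired simple Clifford module for $(V^*,h^* )$ of symmetry type $\sigma$ and adjoint type $s$. Then the following statements are equivalent for a polyform $\alpha\in\wedge V^*$: (a) $\alpha$ is a signed square of some spinor $\xi\in\Sigma$, i.e. it lies in the set $Z(\boldsymbol{\Sigma})$. (b) $\alpha$ satisfies the relations $$\alpha\diamond\alpha=\mathcal{S}(\alpha)\,\alpha,\qquad(\pi^{\frac{1-s}{2}}\circ\tau)(\alpha)=\sigma\,\alpha,\qquad\alpha\diamond\beta\diamond\alpha=\mathcal{S}(\alpha\diamond\beta)\,\alpha$$ for a fixed polyform $\beta\in\wedge V^*$ which satisfies $\mathcal{S}(\alpha\diamond\beta)\neq0$. (c) The relations $$(\pi^{\frac{1-s}{2}}\circ\tau)(\alpha)=\sigma\,\alpha,\qquad\alpha\diamond\beta\diamond\alpha=\mathcal{S}(\alpha\diamond\beta)\,\alpha$$ hold for any polyform $\beta\in\wedge V^*$. In particular, the set $Z(\boldsymbol{\Sigma})$ depends only on $\sigma$, $s$ and $(V^*,h^* )$.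
   Context: $V$ is an oriented real vector space of even dimension $d=p+q\geq 2$ with a non-degenerate metric $h$ of signature $(p,q)$, $p-q\equiv0,2\pmod 8$, and $(V^*,h^* )$ is its dual. $\mathrm{Cl}(V^*,h^* )$ is the real Clifford algebra with $\theta^2=+h^*(\theta,\theta)$ for $\theta\in V^*$. $\pi$ is its automorphism acting as $-1$ on $V^*$ and $\tau$ its anti-automorphism acting as the identity on $V^*$. In these signatures there is a unique irreducible real module $\Sigma$, of dimension $2^{d/2}$, and its representation map $\gamma:\mathrm{Cl}(V^*,h^* )\to\mathrm{End}(\Sigma)$ is an isomorphism. Elements of $\Sigma$ are called spinors and elements of $\wedge V^*$ are called polyforms. A paired simple Clifford module $(\Sigma,\gamma,\mathscr{B})$ of symmetry type $\sigma\in\{-1,1\}$ and adjoint type $s\in\{-1,1\}$ consists of this module and an admissible pairing, i.e. a non-degenerate bilinear form $\mathscr{B}$ on $\Sigma$ with $\mathscr{B}(\xi_1,\xi_2)=\sigma\mathscr{B}(\xi_2,\xi_1)$ and $\mathscr{B}(\gamma(x)\xi_1,\xi_2)=\mathscr{B}(\xi_1,\gamma((\pi^{\frac{1-s}{2}}\circ\tau)(x))\xi_2)$ for all $x\in\mathrm{Cl}(V^*,h^* )$ and $\xi_1,\xi_2\in\Sigma$. The geometric product $\diamond$ is the unique unital associative bilinear product on $\wedge V^*$ with $\theta\diamond\alpha=\theta\wedge\alpha+\iota_{\theta^\sharp}\alpha$ for $\theta\in V^*$. $\Psi_\gamma:(\wedge V^*,\diamond)\to(\mathrm{End}(\Sigma),\circ)$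 is the unique isomorphism of unital algebras with $\Psi_\gamma(\theta)=\gamma(\theta)$ for $\theta\in V^*$. On $\wedge V^*$, $\pi$ acts on degree $k$ as $(-1)^k$ and $\tau$ as $(-1)^{k(k-1)/2}$. $\mathcal{S}(\alpha)=\mathrm{tr}(\Psi_\gamma(\alpha))=2^{d/2}\alpha^{(0)}$, where $\alpha^{(0)}$ is the degree zero part of $\alpha$. The signed squares of $\xi\in\Sigma$ are the polyforms $\pm\Psi_\gamma^{-1}(\xi\otimes\xi^* )$ with $\xi^*=\mathscr{B}(-,\xi)$, and $Z(\boldsymbol{\Sigma})\subset\wedge V^*$ is the set of all signed squares of elements of $\Sigma$.
   Formalization: The equivalence of (a) and (b), with β part of condition (b), is stated for α ≠ 0 only: α = 0 satisfies (a) and (c) but no β has 𝒮(0⋄β) ≠ 0. For β given in advance with 𝒮(α⋄β) ≠ 0, and for (a)⇔(c), nothing is changed. *)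

(* Defs.v *)
From HB Require Import structures.
From mathcomp Require Import all_boot all_order all_algebra sesquilinear.
From mathcomp Require Import all_classical reals.

Set Implicit Arguments.
Unset Strict Implicit.
Unset Printing Implicit Defensive.

Import Order.TTheory GRing.Theory Num.Theory.

Local Open Scope ring_scope.

Definition dual (R : realType) (V : vectType R) : vectType R := 'Hom(V, R^o).

(* A polyform on V is encoded by a single function on finite sequences of
   vectors: its component of degree k is the alternating k-linear form obtained
   by restricting the function to sequences of size k.  Components of degree
   larger than dim V vanish automatically, so this is the whole exterior
   algebra of the dual of V, and nothing more. *)
Section Polyforms.
Variables (R : realType) (V : vectType R).
Implicit Types (f g : seq V -> R^o) (s t : seq V) (u v : V) (theta : dual V).

Definition multilinear f : Prop :=
  forall s t (a : R) u v,
    f (s ++ (a *: u + v) :: t) = a * f (s ++ u :: t) + f (s ++ v :: t).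

Definition alternating f : Prop := forall s, ~~ uniq s -> f s = 0.

Definition polyform_pred : {pred seq V -> R^o} :=
  fun f => `[< multilinear f /\ alternating f >].

Fact polyform_submod_closed : submod_closed polyform_pred.
Proof.
split=> [|a f g /asboolP[mf af] /asboolP[mg ag]]; apply/asboolP; split.
- by move=> s t a u v; rewrite /= mulr0 addr0.
- by [].
- move=> s t b u v; rewrite !fctE mf mg /=.
  rewrite [a *: (_ + _)]mulrDr mulrDr [LHS]addrACA; congr (_ + _ + _).
  by rewrite [LHS]mulrCA.
- by move=> s us; rewrite !fctE af // ag // addr0 [_ *: _]mulr0.
Qed.

HB.instance Definition _ :=
  GRing.isSubmodClosed.Build R (seq V -> R^o) polyform_pred
    polyform_submod_closed.

Record polyform := Polyform {
  polyform_fun :> seq V -> R^o;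
  polyformP : polyform_fun \in polyform_pred }.

HB.instance Definition _ := [isSub for polyform_fun].
HB.instance Definition _ := [Choice of polyform by <:].
HB.instance Definition _ := [SubChoice_isSubLmodule of polyform by <:].

Lemma alternating_adj f : multilinear f ->
  (forall s t v, f (s ++ v :: v :: t) = 0) -> alternating f.
Proof.
move=> mf af.
have mD s t u v : f (s ++ (u + v) :: t) = f (s ++ u :: t) + f (s ++ v :: t).
  by rewrite -{1}[u]scale1r mf mul1r.
have swap s t u v : f (s ++ u :: v :: t) = - f (s ++ v :: u :: t).
  apply/eqP; rewrite -addr_eq0; apply/eqP.
  have := af s t (u + v); rewrite mD.
  have -> w : f (s ++ w :: (u + v) :: t)
      = f (s ++ w :: u :: t) + f (s ++ w :: v :: t).
    by have := mD (rcons s w) t u v; rewrite !cat_rcons.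
  rewrite (_ : f (s ++ v :: (u + v) :: t)
      = f (s ++ v :: u :: t) + f (s ++ v :: v :: t)); last first.
    by have := mD (rcons s v) t u v; rewrite !cat_rcons.
  by rewrite !af add0r addr0.
have rep m v : forall s t, f (s ++ v :: m ++ v :: t) = 0.
  elim/last_ind: m => [|m w IH] s t /=; first exact: af.
  rewrite cat_rcons -cat_cons catA swap -catA cat_cons.
  by rewrite IH oppr0.
suff H t : ~~ uniq t -> forall s, f (s ++ t) = 0.
  by move=> s us; rewrite -[s]cat0s H.
elim: t => [//|v t IH] /=; rewrite negb_and negbK => /orP[vt|nt] s.
  by case/splitPr: vt => m t'; apply: rep.
by rewrite -cat_rcons IH.
Qed.

(* (theta /\ alpha)(v_0, ..., v_k) = \sum_i (-1)^i theta(v_i)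
   alpha(v_0, ..., v_(i-1), v_(i+1), ..., v_k) *)
Definition wedge1_fun theta f : seq V -> R^o := fun s =>
  \sum_(i < size s)
    (-1) ^+ i * theta (nth 0 s i) * f (take i s ++ drop i.+1 s).

Definition contract_fun v f : seq V -> R^o := fun s => f (v :: s).

Lemma wedge1_cons theta f v s : wedge1_fun theta f (v :: s) =
  theta v * f s - wedge1_fun theta (contract_fun v f) s.
Proof.
rewrite /wedge1_fun /= big_ord_recl /= expr0 mul1r drop0; congr (_ + _).
rewrite -sumrN; apply: eq_bigr => i _.
by rewrite /bump /= add1n exprS !mulNr mul1r.
Qed.

Lemma contract_multilinear v f : multilinear f -> multilinear (contract_fun v f).
Proof. by move=> mf s t; apply: (mf (v :: s) t). Qed.

Lemma wedge1_multilinear theta f :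
  multilinear f -> multilinear (wedge1_fun theta f).
Proof.
move=> mf s; elim: s f mf => [|w s IH] f mf t a u v /=; last first.
  rewrite !wedge1_cons IH; last exact: contract_multilinear.
  by rewrite mf mulrDr opprD addrACA mulrBr (mulrCA (theta w)).
rewrite !wedge1_cons linearP /=.
have mlin b g1 g2 t' : wedge1_fun theta (fun s => b * g1 s + g2 s) t' =
    b * wedge1_fun theta g1 t' + wedge1_fun theta g2 t'.
  rewrite /wedge1_fun mulr_sumr -big_split; apply: eq_bigr => i _ /=.
  by rewrite mulrDr mulrCA.
rewrite (_ : contract_fun (a *: u + v) f =
  fun s => a * contract_fun u f s + contract_fun v f s); last first.
  by apply/funext => s; apply: (mf [::]).
rewrite mlin mulrDl opprD addrACA mulrBr; congr (_ + _ + _).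
by rewrite -mulrA.
Qed.

Lemma polyform_multilinear (alpha : polyform) : multilinear alpha.
Proof. by have /asboolP[] := polyformP alpha. Qed.

Lemma polyform_alternating (alpha : polyform) : alternating alpha.
Proof. by have /asboolP[] := polyformP alpha. Qed.

Fact wedge1_subproof theta (alpha : polyform) :
  wedge1_fun theta alpha \in polyform_pred.
Proof.
have wm := wedge1_multilinear theta (polyform_multilinear alpha).
apply/asboolP; split; first exact: wm.
apply: alternating_adj wm _.
have : alternating alpha by exact: polyform_alternating.
move: (alpha : seq V -> R^o) => f af s.
elim: s f af => [|w s IH] f af t v /=.
  rewrite !wedge1_cons /contract_fun.
  rewrite (_ : wedge1_fun _ _ _ = 0); first by rewrite subr0 subrr.
  by rewrite /wedge1_fun big1 // => i _; rewrite af ?mulr0 //= inE eqxx.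
rewrite wedge1_cons IH ?subr0; last first.
  by move=> t' ut'; apply: af; rewrite /= negb_and ut' orbT.
rewrite af ?mulr0 // cat_uniq /= inE eqxx /=.
by rewrite !andbF.
Qed.

Definition wedge1 theta (alpha : polyform) : polyform :=
  Polyform (wedge1_subproof theta alpha).

Fact contract_subproof v (alpha : polyform) :
  contract_fun v alpha \in polyform_pred.
Proof.
apply/asboolP; split.
  exact: contract_multilinear (polyform_multilinear alpha).
move=> s us; apply: polyform_alternating.
by rewrite /= negb_and us orbT.
Qed.

Definition contract v (alpha : polyform) : polyform :=
  Polyform (contract_subproof v alpha).

Definition degree_scale_fun (c : nat -> R) f : seq V -> R^o :=
  fun s => c (size s) * f s.

Fact degree_scale_subproof c (alpha : polyform) :
  degree_scale_fun c alpha \in polyform_pred.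
Proof.
apply/asboolP; split=> [s t a u v|s us]; rewrite /degree_scale_fun.
  by rewrite polyform_multilinear !size_cat /= mulrDr mulrCA.
by rewrite polyform_alternating // mulr0.
Qed.

(* multiplication by c k on the component of degree k *)
Definition degree_scale c (alpha : polyform) : polyform :=
  Polyform (degree_scale_subproof c alpha).

Definition polyform_pi : polyform -> polyform :=
  degree_scale (fun k => (-1) ^+ k).

Definition polyform_tau : polyform -> polyform :=
  degree_scale (fun k => (-1) ^+ (k * k.-1)./2).

Definition one_fun : seq V -> R^o := fun s => (s == [::])%:R.

Fact one_subproof : one_fun \in polyform_pred.
Proof.
apply/asboolP; split=> [s t a u v|[|v s]] //; rewrite /one_fun.
by case: s => [|w s] /=; rewrite mulr0 addr0.
Qed.

Definition polyform1 : polyform := Polyform one_subproof.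

Definition of_dual_fun theta : seq V -> R^o :=
  fun s => if s is [:: v] then theta v else 0.

Fact of_dual_subproof theta : of_dual_fun theta \in polyform_pred.
Proof.
apply/asboolP; split; last by case=> [|v []].
case=> [|w [|w' s]] [|x t] a u v /=; rewrite ?mulr0 ?addr0 //.
by rewrite linearP.
Qed.

Definition of_dual theta : polyform := Polyform (of_dual_subproof theta).

End Polyforms.

Section Metric.
Variables (R : realType) (V : vectType R) (h : {symmetric V}).

Definition has_signature (p q : nat) : Prop :=
  exists e : (p + q).-tuple V,
    basis_of fullv e /\
    forall i j : 'I_(p + q),
      h (tnth e i) (tnth e j) =
        if i == j then (if (i < p)%N then 1 else -1) else 0.

Definition flat : 'Hom(V, dual V) := 
  linfun (fun v => linfun (h v : V -> R^o) : dual V).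

Definition sharp (theta : dual V) : V := (flat^-1)%VF theta.

Definition dual_metric (theta eta : dual V) : R := h (sharp theta) (sharp eta).

Record geometric_product (dia : polyform V -> polyform V -> polyform V) :
    Prop := GeometricProduct {
  geoDl : forall (a : R) x y z, dia (a *: x + y) z = a *: dia x z + dia y z;
  geoDr : forall (a : R) x y z, dia x (a *: y + z) = a *: dia x y + dia x z;
  geoA : forall x y z, dia x (dia y z) = dia (dia x y) z;
  geo1l : forall x, dia (polyform1 V) x = x;
  geo1r : forall x, dia x (polyform1 V) = x;
  geo_dual : forall theta x,
    dia (of_dual theta) x = wedge1 theta x + contract (sharp theta) x }.

(* Cl(V^*, h^* ), given by its universal property, with its automorphism pi and
   its anti-automorphism tau *)
Record cliffordAlgebra := CliffordAlgebra {
  cl :> algType R;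
  cl_in : {linear dual V -> cl};
  cl_sqr : forall theta, cl_in theta * cl_in theta = (dual_metric theta theta)%:A;
  cl_universal : forall (A : algType R) (f : {linear dual V -> A}),
    (forall theta, f theta * f theta = (dual_metric theta theta)%:A) ->
    exists F : {lrmorphism cl -> A},
      (forall theta, F (cl_in theta) = f theta) /\
      (forall G : {lrmorphism cl -> A},
         (forall theta, G (cl_in theta) = f theta) -> G =1 F);
  cl_pi : {lrmorphism cl -> cl};
  cl_pi_in : forall theta, cl_pi (cl_in theta) = - cl_in theta;
  cl_tau : {linear cl -> cl};
  cl_tau1 : cl_tau 1 = 1;
  cl_tauM : forall x y, cl_tau (x * y) = cl_tau y * cl_tau x;
  cl_tau_in : forall theta, cl_tau (cl_in theta) = cl_in theta }.

End Metric.

(* pi^((1 - s) / 2) o tau *)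
Definition twist (T : Type) (pi tau : T -> T) (s : int) (x : T) : T :=
  iter `|((1 - s) %/ 2)%Z| pi (tau x).

Section Modules.
Variables (R : realType) (V : vectType R) (h : {symmetric V}).
Variable (C : cliffordAlgebra h).

Record is_module (S : vectType R) (gamma : {linear C -> 'End(S)}) : Prop :=
  IsModule {
    module1 : gamma 1 = \1%VF;
    moduleM : forall x y, gamma (x * y) = (gamma x \o gamma y)%VF }.

Definition irreducible_module (S : vectType R) (gamma : {linear C -> 'End(S)}) :
    Prop :=
  [/\ is_module gamma, \dim {:S} != 0%N &
      forall W : {vspace S}, (forall x, (gamma x @: W <= W)%VS) ->
        W = 0%VS \/ W = fullv].

Record pairedModule (sigma s : int) := PairedModule {
  spinor :> vectType R;
  gamma : {linear C -> 'End(spinor)};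
  gamma_irreducible : irreducible_module gamma;
  pairing : {biscalar spinor};
  pairing_nondegenerate :
    forall xi, (forall xi', pairing xi xi' = 0) -> xi = 0;
  pairing_symmetry :
    forall xi1 xi2, pairing xi1 xi2 = sigma%:~R * pairing xi2 xi1;
  pairing_adjoint : forall x xi1 xi2,
    pairing (gamma x xi1) xi2
    = pairing xi1 (gamma (twist (cl_pi C) (cl_tau C) s x) xi2) }.

Definition lftrace (S : vectType R) (f : 'End(S)) : R :=
  \tr (passmx.mxof (vbasis {:S}) (vbasis {:S}) f).

Variables (sigma s : int) (S : pairedModule sigma s).

Record is_Psi (dia : polyform V -> polyform V -> polyform V)
    (Psi : {linear polyform V -> 'End(S)}) : Prop := IsPsi {
  Psi1 : Psi (polyform1 V) = \1%VF;
  PsiM : forall x y, Psi (dia x y) = (Psi x \o Psi y)%VF;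
  Psi_dual : forall theta, Psi (of_dual theta) = gamma S (cl_in C theta);
  Psi_bij : bijective Psi }.

Definition trace_form (Psi : {linear polyform V -> 'End(S)})
    (alpha : polyform V) : R := lftrace (Psi alpha).

(* xi (x) xi^*, with xi^* = B(-, xi) *)
Definition spinor_square (xi : S) : 'End(S) :=
  linfun (fun chi : S => pairing S chi xi *: xi).

(* As Psi is bijective, alpha = +- Psi^-1(xi (x) xi^* ) is expressed by applying
   Psi to both sides. *)
Definition signed_squares (Psi : {linear polyform V -> 'End(S)}) :
    set (polyform V) :=
  [set alpha | exists xi : S,
     Psi alpha = spinor_square xi \/ Psi alpha = - spinor_square xi].

End Modules.

(* Main.v *)
From HB Require Import structures.
Require Import Defs.
From mathcomp Require Import all_boot all_order all_algebra sesquilinear.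
From mathcomp Require Import all_classical reals.

Set Implicit Arguments.
Unset Strict Implicit.
Unset Printing Implicit Defensive.

Import Order.TTheory GRing.Theory Num.Theory.

Local Open Scope ring_scope.

(** Through Psi everything takes place in End(S).  Write A for Psi alpha and
    B for the pairing.  Up to sign and scale, xi (x) xi^* is the general
    endomorphism that has rank at most one and satisfies
    B(A x, y) = sigma B(x, A y): if A x is always a multiple c(x) xi, this
    identity reads c(x) B(xi, y) = sigma c(y) B(x, xi), so that c is
    proportional to B(-, xi), and over the reals the factor of proportionality
    is absorbed into xi up to its sign ([rank_le1_signed_square]).  It remains
    to express these two conditions in terms of the polyform alpha.

    Rank.  If A has rank one then A E A = tr(A E) A for every E.  Conversely,
    if A E A is a multiple of A for every E, then A has rank at most one: take
    for E the operators of rank one ([scalar_sandwich_rank_le1]).  A single E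
    is enough when A E A = tr(A E) A and tr(A E) is not zero: A E then has the
    rank of A and is tr(A E) times an idempotent of trace one, and the trace
    of an idempotent is its rank ([sandwich_rank_le1]).

    Symmetry.  The adjoint of Psi alpha for B is
    Psi ((pi^((1 - s) / 2) o tau) alpha) ([Psi_adjoint]).  The pairing gives
    this for the elements of V^*, and both sides reverse products, so one needs
    that V^* generates the algebra of polyforms ([polyform_ind]) and that the
    twist reverses a product with an element of V^* ([twist_dual]).  The first
    comes from the Euler identity [euler], which recovers a form of degree k
    from forms of lower degree; the second from the formula [geo_dual_right]
    for the right multiplication by an element of V^*, which holds because
    that formula defines an operator commuting with all left multiplications.

    In terms of polyforms, the condition that A E A is a multiple of A for
    every E does not mention the trace.  Together with the symmetry relation it
    therefore describes the signed squares by data in which the module does not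
    occur ([signed_squares_scalar_sandwich]); hence they are the same for all
    modules of the same symmetry and adjoint types. *)

(** * Exterior calculus on polyforms *)

Section Exterior.
Variables (R : realType) (V : vectType R).
Implicit Types (alpha beta : polyform V) (theta eta : dual V) (u v : V).
Implicit Types (s t : seq V) (c : nat -> R).

Lemma polyform_ext alpha beta : (forall s, alpha s = beta s) -> alpha = beta.
Proof. by move=> eq_ab; apply/val_inj/funext. Qed.

Lemma polyformDE alpha beta s : (alpha + beta) s = alpha s + beta s.
Proof. by []. Qed.

Lemma polyformZE (a : R) alpha s : (a *: alpha) s = a * alpha s.
Proof. by []. Qed.

Lemma polyformNE alpha s : (- alpha) s = - alpha s.
Proof. by []. Qed.

Lemma polyform_sumE (I : Type) (r : seq I) (P : pred I)
    (F : I -> polyform V) s :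
  (\sum_(i <- r | P i) F i) s = \sum_(i <- r | P i) F i s.
Proof. by elim/big_rec2: _ => [//|i x y _ <-]. Qed.

Lemma wedge1_evalE theta alpha s : wedge1 theta alpha s =
  \sum_(i < size s)
    (-1) ^+ i * theta (nth 0 s i) * alpha (take i s ++ drop i.+1 s).
Proof. by []. Qed.

Lemma degree_scaleE c alpha s : degree_scale c alpha s = c (size s) * alpha s.
Proof. by []. Qed.

Lemma contractE v alpha s : contract v alpha s = alpha (v :: s).
Proof. by []. Qed.

Lemma wedge1E theta alpha v s :
  wedge1 theta alpha (v :: s) =
  theta v * alpha s - wedge1 theta (contract v alpha) s.
Proof. exact: wedge1_cons. Qed.

Lemma wedge1_nil theta alpha : wedge1 theta alpha [::] = 0.
Proof. by rewrite /= /wedge1_fun big_ord0. Qed.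

Lemma wedge1_linear theta : linear (wedge1 theta).
Proof.
move=> a x y; apply: polyform_ext => s; rewrite polyformDE polyformZE.
rewrite !wedge1_evalE mulr_sumr -big_split; apply: eq_bigr => i _.
by rewrite polyformDE polyformZE mulrDr mulrCA.
Qed.

HB.instance Definition _ theta :=
  GRing.isLinear.Build R _ _ _ (wedge1 theta) (wedge1_linear theta).

Lemma contract_linear v : linear (contract v).
Proof. by move=> a x y; apply: polyform_ext. Qed.

HB.instance Definition _ v :=
  GRing.isLinear.Build R _ _ _ (contract v) (contract_linear v).

Lemma degree_scale_linear c : linear (@degree_scale R V c).
Proof.
move=> a x y; apply: polyform_ext => s.
by rewrite !(polyformDE, polyformZE, degree_scaleE) mulrDr mulrCA.
Qed.

HB.instance Definition _ c :=
  GRing.isLinear.Build R _ _ _ (@degree_scale R V c) (degree_scale_linear c).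

Lemma wedge1N theta alpha : wedge1 theta (- alpha) = - wedge1 theta alpha.
Proof. exact: linearN. Qed.

Lemma wedge1B theta : {morph wedge1 theta : alpha beta / alpha - beta}.
Proof. exact: linearB. Qed.

Lemma wedge1Z theta (a : R) alpha :
  wedge1 theta (a *: alpha) = a *: wedge1 theta alpha.
Proof. exact: linearZ. Qed.

Lemma contractN v alpha : contract v (- alpha) = - contract v alpha.
Proof. exact: linearN. Qed.

Lemma contractB v : {morph contract v : alpha beta / alpha - beta}.
Proof. exact: linearB. Qed.

Lemma degree_scaleD c : {morph @degree_scale R V c : alpha beta / alpha + beta}.
Proof. exact: linearD. Qed.

Lemma contract_wedge1 theta v alpha :
  contract v (wedge1 theta alpha) =
  theta v *: alpha - wedge1 theta (contract v alpha).
Proof.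
by apply: polyform_ext => s; rewrite contractE wedge1E.
Qed.

Lemma contract_linearl alpha : linear (fun v => contract v alpha).
Proof.
move=> a u v; apply: polyform_ext => s.
exact: (polyform_multilinear alpha [::]).
Qed.

Lemma contractDl alpha : {morph (fun v => contract v alpha) : u v / u + v}.
Proof.
by move=> u v; rewrite -[u]scale1r contract_linearl !scale1r.
Qed.

Lemma contract_suml (I : Type) (r : seq I) (a : I -> R) (u : I -> V) alpha :
  contract (\sum_(i <- r) a i *: u i) alpha =
  \sum_(i <- r) a i *: contract (u i) alpha.
Proof.
elim: r => [|i r IHr]; last by rewrite !big_cons contract_linearl IHr.
rewrite !big_nil; apply: (@addrI _ (contract 0 alpha)).
by rewrite -contractDl !addr0.
Qed.

Lemma contractC u v alpha :
  contract u (contract v alpha) = - contract v (contract u alpha).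
Proof.
have con2 w : contract w (contract w alpha) = 0.
  apply: polyform_ext => s; rewrite 2!contractE polyform_alternating //.
  by rewrite /= inE eqxx.
apply/eqP; rewrite -addr_eq0 -(con2 (u + v)) !contractDl !linearD /= !con2.
by rewrite add0r addr0.
Qed.

Lemma wedge1C theta eta alpha :
  wedge1 theta (wedge1 eta alpha) = - wedge1 eta (wedge1 theta alpha).
Proof.
apply: polyform_ext => s; elim: s alpha => [|v s IHs] alpha.
  by rewrite polyformNE !wedge1_nil oppr0.
rewrite polyformNE !wedge1E !contract_wedge1 !(wedge1B, wedge1Z).
rewrite !(polyformDE, polyformNE, polyformZE) IHs polyformNE.
by rewrite !(opprB, opprD, opprK) [LHS]addrA.
Qed.

Lemma contract_degree_scale v c alpha :
  contract v (degree_scale c alpha) =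
  degree_scale (fun k => c k.+1) (contract v alpha).
Proof. exact: polyform_ext. Qed.

Lemma degree_scale_wedge1 theta c alpha :
  degree_scale c (wedge1 theta alpha) =
  wedge1 theta (degree_scale (fun k => c k.+1) alpha).
Proof.
apply: polyform_ext => s; rewrite /= /degree_scale_fun /wedge1_fun mulr_sumr.
apply: eq_bigr => i _; rewrite mulrCA; congr (_ * (c _ * _)).
by rewrite size_cat size_take size_drop ltn_ord -addnS subnSK // subnKC // ltnW.
Qed.

Lemma degree_scaleM c c' alpha :
  degree_scale c (degree_scale c' alpha) =
  degree_scale (fun k => c k * c' k) alpha.
Proof. by apply: polyform_ext => s; rewrite /= /degree_scale_fun mulrA. Qed.

Let X := vbasis {:V}.
Definition coord_form (i : 'I_(\dim {:V})) : dual V :=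
  linfun (coord X i : V -> R^o).

(** The Euler identity.  Moving a contraction with v through the left-hand side
    produces one more term i_v alpha, because \sum_i e^i(v) e_i = v; so each
    argument of alpha contributes 1 to the factor. *)
Lemma euler alpha :
  \sum_i wedge1 (coord_form i) (contract X`_i alpha) =
  degree_scale (fun k => k%:R) alpha.
Proof.
apply: polyform_ext => s; rewrite polyform_sumE.
elim: s alpha => [|v s IHs] alpha.
  by rewrite big1 => [|i _]; rewrite ?wedge1_nil //= /degree_scale_fun mul0r.
under eq_bigr do rewrite wedge1E contractC linearN polyformNE opprK.
rewrite big_split IHs !degree_scaleE [size (v :: s)]/=.
rewrite mulrS mulrDl mul1r; congr (_ + _).
transitivity (contract (\sum_i coord_form i v *: X`_i) alpha s).
  by rewrite contract_suml polyform_sumE.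
by under eq_bigr do rewrite lfunE; rewrite -coord_vbasis ?memvf.
Qed.

(** Forms of degree larger than the dimension of V vanish, since so many vectors
    are linearly dependent. *)
Lemma polyform_dependent alpha s : ~~ free s -> alpha s = 0.
Proof.
suff dep t : ~~ free s -> alpha (t ++ s) = 0 by apply: (dep [::]).
elim: s t => [|v s IHs] t; first by rewrite nil_free.
rewrite free_cons negb_and negbK => /orP[vs | nfs]; last first.
  by rewrite -cat_rcons IHs.
rewrite (coord_span (X := in_tuple s) vs) /=.
have -> : forall f : 'I_(size s) -> R, alpha (t ++ (\sum_i f i *: s`_i) :: s) =
    \sum_i f i * alpha (t ++ s`_i :: s).
  move=> f; elim/big_rec2: _ => [|i a w _ <-].
    have := polyform_multilinear alpha t s 1 0 0.
    rewrite scale1r addr0 mul1r => /eqP.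
    by rewrite eq_sym -subr_eq0 addrK => /eqP.
  by rewrite -polyform_multilinear.
rewrite big1 // => i _; rewrite polyform_alternating ?mulr0 //.
by rewrite cat_uniq /= mem_nth // !andbF.
Qed.

Definition degree_part k alpha : polyform V :=
  degree_scale (fun j => (j == k)%:R) alpha.

Lemma degree_decomposition alpha :
  alpha = \sum_(k < (\dim {:V}).+1) degree_part k alpha.
Proof.
apply: polyform_ext => s; rewrite polyform_sumE /= /degree_scale_fun.
rewrite -mulr_suml; have [le_s|gt_s] := ltnP (size s) (\dim {:V}).+1.
  rewrite (bigD1 (Ordinal le_s)) //= eqxx big1 ?addr0 ?mul1r // => i.
  by rewrite eq_sym -val_eqE /= => /negPf->.
rewrite polyform_dependent ?mulr0 //; apply: contraL gt_s => /eqnP <-.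
by rewrite -ltnNge ltnS dimvS ?subvf.
Qed.

(** The operators theta /\ + i_(sh theta) generate all polyforms from 1,
    whatever the map sh is: by the Euler identity a form of degree k > 0 is a
    combination of forms theta /\ beta with beta of degree k - 1, and
    theta /\ beta differs from the value of the operator at beta by a form of
    degree k - 2.  For the musical isomorphism sh this says that V^* generates
    the algebra of polyforms under the geometric product. *)
Lemma polyform_ind (sh : dual V -> V) (P : polyform V -> Prop) :
  P (polyform1 V) ->
  (forall (a : R) alpha beta, P alpha -> P beta -> P (a *: alpha + beta)) ->
  (forall theta alpha, P alpha ->
     P (wedge1 theta alpha + contract (sh theta) alpha)) ->
  forall alpha, P alpha.
Proof.
move=> P1 Plin Pgeo.
have P0 : P 0 by rewrite -(subrr (polyform1 V)) addrC -scaleN1r; apply: Plin.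
have PZ a x : P x -> P (a *: x).
  by move=> Px; rewrite -[_ *: _]addr0; apply: Plin.
have PD x y : P x -> P y -> P (x + y).
  by move=> Px Py; rewrite -[x]scale1r; apply: Plin.
have Psum n (F : 'I_n -> polyform V) : (forall i, P (F i)) -> P (\sum_i F i).
  by move=> PF; elim/big_ind: _.
have part_contract v k alpha :
    contract v (degree_part k.+1 alpha) = degree_part k (contract v alpha).
  by rewrite /degree_part contract_degree_scale.
suff Ppart k : forall alpha, P (degree_part k alpha).
  by move=> alpha; rewrite (degree_decomposition alpha); apply: Psum.
elim/ltn_ind: k => -[|k] IHk alpha.
  suff -> : degree_part 0 alpha = alpha [::] *: polyform1 V by apply: PZ.
  apply: polyform_ext => -[|v s].
    by rewrite polyformZE /= mulr1 [LHS]mul1r.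
  by rewrite polyformZE /= mulr0 [LHS]mul0r.
have -> : degree_part k.+1 alpha = k.+1%:R^-1 *:
    \sum_i wedge1 (coord_form i) (degree_part k (contract X`_i alpha)).
  under eq_bigr do rewrite -part_contract.
  rewrite euler; apply: polyform_ext => s.
  rewrite polyformZE /= /degree_scale_fun /=; case: eqP => [->|_].
    by rewrite mulKf ?pnatr_eq0 ?mul1r.
  by rewrite !mul0r !mulr0.
apply/PZ/Psum => i; move: (contract _ _) => beta.
have -> : wedge1 (coord_form i) (degree_part k beta) =
    (wedge1 (coord_form i) (degree_part k beta) +
     contract (sh (coord_form i)) (degree_part k beta)) +
    (-1) *: contract (sh (coord_form i)) (degree_part k beta).
  by rewrite scaleN1r addrK.
apply: PD; first by apply: Pgeo; apply: IHk.
(* The correction term has degree k - 1, except for k = 0, where it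
   vanishes. *)
apply: PZ; case: k IHk => [|k] IHk; last by rewrite part_contract; apply: IHk.
suff -> : contract (sh (coord_form i)) (degree_part 0 beta) = 0 by [].
by apply: polyform_ext => s; rewrite /= /contract_fun /degree_scale_fun mul0r.
Qed.

End Exterior.

(** * Right multiplication by a covector and reversal of products *)

Section GeometricProduct.
Variables (R : realType) (V : vectType R) (h : {symmetric V}) (p q : nat).
Hypothesis hsig : has_signature h p q.
Variable dia : polyform V -> polyform V -> polyform V.
Hypothesis hdia : geometric_product h dia.
Implicit Types (alpha beta : polyform V) (theta eta : dual V).

Lemma flatE u v : flat h u v = h u v.
Proof.
have lin_h w : linfun (h w : V -> R^o) =1 h w by move=> x; rewrite lfunE.
have lin_flat : linear (fun v => linfun (h v : V -> R^o) : dual V).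
  move=> a x y; apply/lfunP => w.
  by rewrite add_lfunE scale_lfunE !lin_h linearPl.
pose F : {linear V -> dual V} :=
  HB.pack (fun v => linfun (h v : V -> R^o) : dual V)
  (GRing.isLinear.Build R V (dual V) _ _ lin_flat).
by rewrite /flat (lfunE F) /= lin_h.
Qed.

(** A metric which has a signature is non-degenerate: for an orthonormal basis
    the vector \sum_i h(e_i, e_i) theta(e_i) e_i represents theta. *)
Lemma sharpE theta v : h (sharp h theta) v = theta v.
Proof.
suff theta_img : theta \in limg (flat h).
  by rewrite -flatE /sharp limg_lfunVK.
have [e [be eE]] := hsig.
pose eps (i : 'I_(p + q)) : R := if (i < p)%N then 1 else -1.
pose w := \sum_i (eps i * theta (tnth e i)) *: tnth e i.
suff -> : theta = flat h w by rewrite memv_img ?memvf.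
have flat_basis j : theta (tnth e j) = flat h w (tnth e j).
  rewrite flatE linear_sumlz (bigD1 j) //= big1 => [|i].
    rewrite linearZl_LR /= eE eqxx addr0 mulrAC /eps.
    by case: ifP => _; rewrite ?mulrNN !mul1r.
  by move=> /negPf ij; rewrite linearZl_LR /= eE ij mulr0.
apply/lfunP => x; rewrite (coord_basis be (memvf x)).
rewrite [LHS]linear_sum [RHS]linear_sum.
apply: eq_bigr => j _; rewrite [LHS]linearZ [RHS]linearZ; congr (_ *: _).
by have := flat_basis j; rewrite (tnth_nth 0).
Qed.

Lemma sharp_sym theta eta : eta (sharp h theta) = theta (sharp h eta).
Proof. by rewrite -!sharpE hermC expr0 mul1r. Qed.

Lemma polyform_pi_wedge1 theta alpha :
  polyform_pi (wedge1 theta alpha) = - wedge1 theta (polyform_pi alpha).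
Proof.
rewrite /polyform_pi degree_scale_wedge1 -linearN; congr wedge1.
apply: polyform_ext => s.
by rewrite polyformNE !degree_scaleE exprS !mulNr mul1r.
Qed.

Lemma polyform_pi_contract v alpha :
  polyform_pi (contract v alpha) = - contract v (polyform_pi alpha).
Proof.
rewrite /polyform_pi contract_degree_scale.
apply: polyform_ext => s.
by rewrite polyformNE !degree_scaleE exprS !mulNr mul1r opprK.
Qed.

Lemma contract_polyform1 v : contract v (polyform1 V) = 0.
Proof. exact: polyform_ext. Qed.

Lemma wedge1_polyform1 theta : wedge1 theta (polyform1 V) = of_dual theta.
Proof.
apply: polyform_ext => -[|v s]; first by rewrite wedge1_nil.
rewrite wedge1E contract_polyform1 linear0 subr0.
by case: s => [|w s] /=; rewrite /one_fun ?mulr1 ?mulr0.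
Qed.

Lemma polyform_pi1 : polyform_pi (polyform1 V) = polyform1 V.
Proof.
apply: polyform_ext => -[|v s]; first by rewrite degree_scaleE mul1r.
by rewrite degree_scaleE mulr0.
Qed.

(** The right-hand side is an operator in alpha which sends 1 to theta.  It
    commutes with each left multiplication by a covector eta, because
    eta /\ + i_eta and theta /\ - i_theta anticommute, as h^* is symmetric, and
    pi anticommutes with both.  Right multiplication by theta has the same two
    properties, and these determine an operator since the covectors generate all
    polyforms. *)
Lemma geo_dual_right theta alpha :
  dia alpha (of_dual theta) =
  wedge1 theta (polyform_pi alpha)
  - contract (sharp h theta) (polyform_pi alpha).
Proof.
elim/(@polyform_ind _ _ (sharp h)): alpha => [|a x y IHx IHy|eta x IHx].
- rewrite (geo1l hdia) polyform_pi1 wedge1_polyform1.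
  by rewrite contract_polyform1 subr0.
- rewrite (geoDl hdia) IHx IHy /polyform_pi !linearP [RHS]addrACA.
  by rewrite scalerDr.
rewrite -(geo_dual hdia) -(geoA hdia) IHx !(geo_dual hdia).
have -> : polyform_pi (wedge1 eta x + contract (sharp h eta) x) =
    - (wedge1 eta (polyform_pi x)) - contract (sharp h eta) (polyform_pi x).
  by rewrite -polyform_pi_wedge1 -polyform_pi_contract /polyform_pi linearD.
move: (polyform_pi x) => {IHx}x.
rewrite !(wedge1B, contractB, wedge1N, contractN) !contract_wedge1.
rewrite (wedge1C eta theta) (contractC (sharp h eta)) (sharp_sym theta eta).
rewrite !opprD !opprK -!addrA; congr (_ + _).
by rewrite addrCA [RHS]addrCA; congr (_ + _); rewrite addrCA.
Qed.

Lemma twistE (s : int) (alpha : polyform V) : s = 1 \/ s = -1 ->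
  twist (@polyform_pi R V) (@polyform_tau R V) s alpha =
  degree_scale (fun k => s%:~R ^+ k * (-1) ^+ (k * k.-1)./2) alpha.
Proof.
case=> ->; apply: polyform_ext => t; rewrite /twist.
  rewrite (_ : `|_|%N = 0%N) //= /degree_scale_fun.
  by rewrite expr1n mul1r.
rewrite (_ : `|_|%N = 1%N) //= /degree_scale_fun.
by rewrite mulrA.
Qed.

(** The twist is an anti-automorphism of the geometric product; a product whose
    first factor is a covector is the only case that an induction over
    [polyform_ind] requires.  By [geo_dual_right] it amounts to the relation
    between the signs of consecutive degrees. *)
Lemma twist_dual (s : int) theta alpha : s = 1 \/ s = -1 ->
  let tw := twist (@polyform_pi R V) (@polyform_tau R V) s in
  tw (dia (of_dual theta) alpha) = s%:~R *: dia (tw alpha) (of_dual theta).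
Proof.
move=> hs /=; rewrite !twistE // geo_dual_right (geo_dual hdia).
set c := fun k => _ * _.
have cS k : c k.+1 = s%:~R * ((-1) ^+ k * c k).
  rewrite /c exprS -!mulrA; congr (_ * _); rewrite mulrCA; congr (_ * _).
  have -> : (k.+1 * k.+1.-1)./2 = (k + (k * k.-1)./2)%N.
    rewrite -!bin2 binS bin1 addnC //.
  by rewrite exprD.
have s2 : s%:~R * s%:~R = 1 :> R by case: hs => ->; rewrite ?mulrNN mulr1.
rewrite degree_scaleD degree_scale_wedge1 /polyform_pi degree_scaleM.
rewrite scalerBr; congr (_ + _).
  rewrite -linearZ; congr wedge1; apply: polyform_ext => t.
  by rewrite polyformZE !degree_scaleE cS -!mulrA.
rewrite contract_degree_scale -scaleN1r scalerA; apply: polyform_ext => t.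
rewrite polyformZE !degree_scaleE.
rewrite cS exprS mulN1r (mulrCA _ s%:~R) !mulNr !mul1r signrMK.
by rewrite !(mulrN, mulNr) opprK !mulrA s2 mul1r.
Qed.

End GeometricProduct.

(** * Endomorphisms of rank at most one *)

Section RankOne.
Import passmx.
Variables (R : realType) (S : vectType R).
Implicit Types (A B : 'End(S)) (g : 'Hom(S, R^o)).

Definition rank_le1 A := exists xi, forall v, exists c : R, A v = c *: xi.

Lemma lftrace_rank1 A g xi : (forall v, A v = g v *: xi) -> lftrace A = g xi.
Proof.
move=> AE; rewrite [in RHS](coord_vbasis (memvf xi)) linear_sum.
rewrite /lftrace /mxtrace.
apply: eq_bigr => i _.
rewrite mxE /= mxE vecof_delta AE linearZ [RHS]linearZ; exact: mulrC.
Qed.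

Lemma lftraceN A : lftrace (- A) = - lftrace A.
Proof. by rewrite /lftrace linearN linearN. Qed.

(** Factor the matrix of A as a = c r with c injective and r surjective.  The
    hypothesis becomes r b c = t, a scalar matrix of size rank(A), whose
    trace is also tr(A B) = t; hence rank(A) = 1. *)
Lemma sandwich_rank_le1 A B (t : R) : t != 0 -> t = lftrace (A \o B)%VF ->
  (A \o B \o A)%VF = t *: A -> rank_le1 A.
Proof.
set X := vbasis {:S}; have bX : basis_of {:S} X by apply: vbasisP.
move=> t_neq0 tE ABA.
pose a := mxof X X A; pose b := mxof X X B.
have aba : a *m b *m a = t *: a.
  have -> : t *: a = mxof X X (t *: A) by rewrite linearZ.
  by rewrite -ABA !(mxof_comp _ _ bX) mulmxA.
move: (col_base a) (row_base a) (mulmx_base a) (col_base_full a)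
  (row_base_free a).
move=> c r aE c_full r_free.
have rbc : r *m b *m c = t%:M.
  apply/(row_free_inj r_free)/(row_full_inj c_full) => /=.
  by rewrite mul_scalar_mx -scalemxAr !mulmxA aE -(mulmxA _ c) aE.
have rk1 : \rank a = 1%N.
  have trE : t * (\rank a)%:R = t.
    rewrite {2}tE /lftrace (mxof_comp _ _ bX) -/a -/b.
    by rewrite -{2}aE mulmxA mxtrace_mulC mulmxA rbc mxtrace_scalar mulr_natr.
  by apply/eqP; rewrite -(eqr_nat R) -(inj_eq (mulfI t_neq0)) trE mulr1.
move: c r aE {c_full r_free rbc}; rewrite rk1 => c r aE.
exists (vecof X r) => v; exists ((rVof X v *m c) 0 0).
rewrite -linearZ /= -mul_scalar_mx -mx11_scalar -mulmxA aE mul_mxof.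
by rewrite !rVofK.
Qed.

End RankOne.

(** * Signed squares in the endomorphism algebra *)

Section PairedModule.
Variables (R : realType) (V : vectType R) (h : {symmetric V}).
Variables (C : cliffordAlgebra h) (sigma s : int) (S : pairedModule C sigma s).
Implicit Types (xi chi psi : S) (A B : 'End(S)).

Lemma spinor_squareE xi chi : spinor_square xi chi = pairing S chi xi *: xi.
Proof.
have lin : linear (fun chi => pairing S chi xi *: xi).
  by move=> a x y; rewrite linearPl scalerDl scalerA.
pose F : {linear S -> S} := HB.pack (fun chi => pairing S chi xi *: xi)
  (GRing.isLinear.Build R S S _ _ lin).
exact: (lfunE F).
Qed.

Lemma spinor_square0 : @spinor_square _ _ _ _ _ _ S 0 = 0.
Proof. by apply/lfunP => chi; rewrite spinor_squareE scaler0 lfunE. Qed.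

Lemma pairing_nondegenerate_right chi :
  (forall xi, pairing S xi chi = 0) -> chi = 0.
Proof.
move=> chi0; apply: pairing_nondegenerate => xi.
by rewrite pairing_symmetry chi0 mulr0.
Qed.

Lemma ex_pairing_neq0 xi : xi != 0 -> exists chi, pairing S xi chi != 0.
Proof.
move=> xi0; apply/not_existsP => all0; move/eqP: xi0; apply.
by apply: pairing_nondegenerate => chi; apply/eqP/contraT => /all0.
Qed.

Definition self_adjoint_upto A :=
  forall xi chi, pairing S (A xi) chi = sigma%:~R * pairing S xi (A chi).

Definition is_signed_square A :=
  exists xi, A = spinor_square xi \/ A = - spinor_square xi.

Lemma spinor_square_self_adjoint xi : self_adjoint_upto (spinor_square xi).
Proof.
move=> x y; rewrite !spinor_squareE linearZl_LR linearZr_LR /=.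
by rewrite (pairing_symmetry xi y) mulrCA [pairing S x xi * _]mulrC.
Qed.

Lemma self_adjoint_uptoN A : self_adjoint_upto A -> self_adjoint_upto (- A).
Proof. by move=> sA x y; rewrite !opp_lfunE linearNl linearNr sA mulrN. Qed.

Lemma signed_square_self_adjoint A : is_signed_square A -> self_adjoint_upto A.
Proof.
case=> xi [] ->; first exact: spinor_square_self_adjoint.
exact/self_adjoint_uptoN/spinor_square_self_adjoint.
Qed.

(** Both sides send x to <x, xi> <B xi, xi> xi, where <-, -> is the pairing. *)
Lemma spinor_square_sandwich xi B :
  (spinor_square xi \o B \o spinor_square xi)%VF =
  lftrace (spinor_square xi \o B) *: spinor_square xi.
Proof.
pose F : 'Hom(S, R^o) := linfun (applyr (pairing S) xi : S -> R^o).
have FE x : F x = pairing S x xi by rewrite lfunE.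
rewrite (@lftrace_rank1 _ _ _ (F \o B)%VF xi) => [|x]; last first.
  by rewrite !comp_lfunE spinor_squareE FE.
apply/lfunP => x; rewrite scale_lfunE !comp_lfunE !spinor_squareE FE.
by rewrite linearZ linearZl_LR /= scalerA mulrC.
Qed.

Lemma signed_square_sandwich A B : is_signed_square A ->
  (A \o B \o A)%VF = lftrace (A \o B) *: A.
Proof.
case=> xi [] ->; first exact: spinor_square_sandwich.
rewrite !comp_lfunNl comp_lfunNr opprK spinor_square_sandwich.
by rewrite lftraceN scalerN scaleNr opprK.
Qed.

(** If A is a signed square of xi, any psi with <xi, psi> nonzero works, as the
    trace is <xi, psi> <psi, xi> up to sign. *)
Lemma signed_square_trace A : is_signed_square A -> A != 0 ->
  exists psi, lftrace (A \o spinor_square psi) != 0.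
Proof.
move=> [xi AE] A_neq0; have xi_neq0 : xi != 0.
  apply: contra_neq A_neq0 => xi0.
  by case: AE => ->; rewrite xi0 spinor_square0 ?oppr0.
have [psi k_neq0] := ex_pairing_neq0 xi_neq0.
exists psi.
have sq_neq0 : lftrace (spinor_square xi \o spinor_square psi)%VF != 0.
  pose F : 'Hom(S, R^o) := linfun (applyr (pairing S) psi : S -> R^o).
  have FE x : F x = pairing S x psi by rewrite lfunE.
  rewrite (@lftrace_rank1 _ _ _ F (spinor_square xi psi)) => [|x].
    rewrite FE spinor_squareE linearZl_LR /= mulf_neq0 //.
    by move: k_neq0; rewrite pairing_symmetry mulf_eq0 negb_or => /andP[].
  by rewrite comp_lfunE (spinor_squareE psi) FE linearZ.
by case: AE => -> //; rewrite comp_lfunNl lftraceN oppr_eq0.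
Qed.

(** If A x = c(x) xi and <xi, psi> = k is not zero, the symmetry of A yields
    k c(x) = sigma c(psi) <x, xi>, so A = d (xi (x) xi^* ) with
    d = sigma c(psi) / k, and sqrt |d| xi is the required spinor. *)
Lemma rank_le1_signed_square A :
  rank_le1 A -> self_adjoint_upto A -> is_signed_square A.
Proof.
move=> [xi Axi] sA; have [xi0 | xi_neq0] := eqVneq xi 0.
  exists 0; left; rewrite spinor_square0; apply/lfunP => x; rewrite lfunE.
  by have [c ->] := Axi x; rewrite xi0 scaler0.
have [psi k_neq0] := ex_pairing_neq0 xi_neq0.
have [b Apsi] := Axi psi.
set k := pairing S xi psi in k_neq0; pose d := sigma%:~R * b / k.
have AE x : A x = d *: (pairing S x xi *: xi).
  have [c Ax] := Axi x; rewrite Ax scalerA; congr (_ *: _).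
  apply: (mulIf k_neq0); have := sA x psi.
  rewrite Ax Apsi linearZl_LR linearZr_LR /= -/k => ->.
  by rewrite [RHS]mulrAC /d divfK // mulrA.
have sqE x : spinor_square (Num.sqrt `|d| *: xi) x =
    `|d| *: (pairing S x xi *: xi).
  rewrite spinor_squareE linearZr_LR /= !scalerA; congr (_ *: _).
  by rewrite mulrAC -expr2 sqr_sqrtr.
exists (Num.sqrt `|d| *: xi); case: (lerP 0 d) => d0; [left | right].
  by apply/lfunP => x; rewrite sqE AE ger0_norm.
by apply/lfunP => x; rewrite opp_lfunE sqE AE ltr0_norm // scaleNr opprK.
Qed.

(** Choose u and chi with <A u, chi> not zero and put the operator
    x |-> <x, chi> v in the middle: the value at u of the hypothesis is
    <A u, chi> A v = c A u, so every A v lies on the line of A u. *)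
Lemma scalar_sandwich_rank_le1 A :
  (forall B, exists c : R, (A \o B \o A)%VF = c *: A) -> rank_le1 A.
Proof.
move=> ABA; have [A0 | A_neq0] := eqVneq A 0.
  by exists 0 => v; exists 0; rewrite A0 lfunE scale0r.
have [u Au_neq0] : exists u, A u != 0.
  apply/not_existsP => all0; move/eqP: A_neq0; apply.
  by apply/lfunP => u; rewrite lfunE; apply/eqP/contraT => /all0.
have [chi k_neq0] := ex_pairing_neq0 Au_neq0.
exists (A u) => v.
have lin : linear (fun x => pairing S x chi *: v).
  by move=> a x y; rewrite linearPl scalerDl scalerA.
pose F : {linear S -> S} := HB.pack (fun x => pairing S x chi *: v)
  (GRing.isLinear.Build R S S _ _ lin).
have [c /lfunP/(_ u)] := ABA (linfun F).
rewrite scale_lfunE !comp_lfunE lfunE /= linearZ => /(congr1 ( *:%R _)) AvE.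
exists ((pairing S (A u) chi)^-1 * c).
by rewrite -scalerA -AvE /= scalerA mulVf // scale1r.
Qed.

(** * Signed squares among the polyforms *)

Variables (p q : nat) (hsig : has_signature h p q) (hs : s = 1 \/ s = -1).
Variable dia : polyform V -> polyform V -> polyform V.
Hypothesis hdia : geometric_product h dia.
Variables (Psi : {linear polyform V -> 'End(S)}) (hPsi : is_Psi dia Psi).

Let tw := twist (@polyform_pi R V) (@polyform_tau R V) s.

Lemma twist_cl_in theta :
  twist (cl_pi C) (cl_tau C) s (cl_in C theta) = s%:~R *: cl_in C theta.
Proof.
rewrite /twist cl_tau_in; case: hs => ->.
  by rewrite (_ : `|_|%N = 0%N) //= scale1r.
by rewrite (_ : `|_|%N = 1%N) //= cl_pi_in scaleN1r.
Qed.

(** True for covectors by the axioms of the pairing, and preserved by left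
    multiplication with a covector because the twist reverses such products. *)
Lemma Psi_adjoint alpha xi chi :
  pairing S (Psi alpha xi) chi = pairing S xi (Psi (tw alpha) chi).
Proof.
elim/(@polyform_ind _ _ (sharp h)): alpha xi chi
  => [|a x y IHx IHy|theta x IHx] xi chi.
- have -> : tw (polyform1 V) = polyform1 V.
    rewrite /tw twistE //; apply: polyform_ext => -[|v t].
      by rewrite degree_scaleE !expr0 !mul1r.
    by rewrite degree_scaleE mulr0.
  by rewrite (Psi1 hPsi) !id_lfunE.
- have -> : tw (a *: x + y) = a *: tw x + tw y.
    by rewrite /tw !twistE // linearP.
  rewrite !linearP !(add_lfunE, scale_lfunE) linearPl linearPr /=.
  by rewrite IHx IHy.
rewrite -(geo_dual hdia) /tw (twist_dual hsig hdia) // linearZ /=.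
rewrite !(PsiM hPsi) scale_lfunE !comp_lfunE (Psi_dual hPsi).
rewrite pairing_adjoint IHx twist_cl_in linearZ scale_lfunE linearZ.
by [].
Qed.

Lemma symm_self_adjoint alpha :
  tw alpha = sigma%:~R *: alpha <-> self_adjoint_upto (Psi alpha).
Proof.
split=> [twE xi chi | sA].
  by rewrite Psi_adjoint twE linearZ scale_lfunE linearZr_LR.
apply: (bij_inj (Psi_bij hPsi)); apply/lfunP => chi; apply/eqP.
rewrite -subr_eq0; apply/eqP/pairing_nondegenerate_right => xi.
by rewrite linearBr /= -Psi_adjoint sA linearZ scale_lfunE linearZr_LR subrr.
Qed.

(** The right-hand side involves neither Psi nor the trace, which gives the
    independence of the signed squares from the module. *)
Lemma signed_squares_scalar_sandwich alpha :
  signed_squares Psi alpha <->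
  tw alpha = sigma%:~R *: alpha /\
  forall beta, exists c : R, dia (dia alpha beta) alpha = c *: alpha.
Proof.
split=> [Za | [/symm_self_adjoint sA sand]].
  split; first exact/symm_self_adjoint/signed_square_self_adjoint.
  move=> beta; exists (lftrace (Psi alpha \o Psi beta)).
  apply: (bij_inj (Psi_bij hPsi)).
  by rewrite linearZ !(PsiM hPsi) signed_square_sandwich.
apply: rank_le1_signed_square sA; apply: scalar_sandwich_rank_le1 => B.
have [g _ gK] := Psi_bij hPsi; have [c sandE] := sand (g B).
by exists c; rewrite -linearZ -sandE !(PsiM hPsi) gK.
Qed.

Lemma signed_squares_sandwich alpha beta : signed_squares Psi alpha ->
  dia (dia alpha beta) alpha = trace_form Psi (dia alpha beta) *: alpha.
Proof.
move=> Za; apply: (bij_inj (Psi_bij hPsi)).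
by rewrite linearZ /trace_form !(PsiM hPsi) signed_square_sandwich.
Qed.

Lemma sandwich_signed_squares alpha beta :
  trace_form Psi (dia alpha beta) != 0 ->
  tw alpha = sigma%:~R *: alpha ->
  dia (dia alpha beta) alpha = trace_form Psi (dia alpha beta) *: alpha ->
  signed_squares Psi alpha.
Proof.
move=> tr_neq0 /symm_self_adjoint sA sand; apply: rank_le1_signed_square sA.
apply: (sandwich_rank_le1 (B := Psi beta) tr_neq0); rewrite /trace_form.
  by rewrite (PsiM hPsi).
by rewrite -!(PsiM hPsi) sand linearZ.
Qed.

Lemma ex_trace_neq0 alpha : alpha != 0 -> signed_squares Psi alpha ->
  exists beta, trace_form Psi (dia alpha beta) != 0.
Proof.
move=> a_neq0 /signed_square_trace [|psi tr_neq0].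
  apply: contra_neq a_neq0 => A0.
  by apply: (bij_inj (Psi_bij hPsi)); rewrite A0 linear0.
have [g _ gK] := Psi_bij hPsi.
by exists (g (spinor_square psi)); rewrite /trace_form (PsiM hPsi) gK.
Qed.

End PairedModule.

Theorem theorem3p20 (R : realType) (V : vectType R) (h : {symmetric V})
    (p q : nat) (hsig : has_signature h p q)
    (d_even : ~~ odd (p + q)) (d_ge2 : (2 <= p + q)%N)
    (hmod8 : (p%:Z - q%:Z = 0 %[mod 8])%Z \/ (p%:Z - q%:Z = 2 %[mod 8])%Z)
    (C : cliffordAlgebra h)
    (dia : polyform V -> polyform V -> polyform V)
    (hdia : geometric_product h dia)
    (sigma s : int) (hsigma : sigma = 1 \/ sigma = -1) (hs : s = 1 \/ s = -1)
    (S : pairedModule C sigma s)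
    (Psi : {linear polyform V -> 'End(S)}) (hPsi : is_Psi dia Psi) :
  let Z := signed_squares Psi in
  let tr := trace_form Psi in
  let symm alpha :=
    twist (@polyform_pi R V) (@polyform_tau R V) s alpha = sigma%:~R *: alpha in
  let sandwich alpha beta :=
    dia (dia alpha beta) alpha = tr (dia alpha beta) *: alpha in
  let relations alpha beta :=
    [/\ dia alpha alpha = tr alpha *: alpha, symm alpha &
        sandwich alpha beta] in
  (forall alpha : polyform V,
    [/\ (* (a) <-> (c) *)
        Z alpha <-> (symm alpha /\ forall beta, sandwich alpha beta),
        (* (a) <-> (b), the polyform beta being part of the condition (b) *)
        alpha != 0 ->
          (Z alpha <->
           exists beta, tr (dia alpha beta) != 0 /\ relations alpha beta) &
        (* (a) <-> (b), the polyform beta being given in advance *)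
        forall beta, tr (dia alpha beta) != 0 ->
          (Z alpha <-> relations alpha beta)])
  /\
  (forall (C' : cliffordAlgebra h) (S' : pairedModule C' sigma s)
      (Psi' : {linear polyform V -> 'End(S')}),
    is_Psi dia Psi' -> signed_squares Psi' = Z).
Proof.
move=> Z tr symm sandwich relations; split; last first.
  move=> C' S' Psi' hPsi'.
  apply/seteqP; split=> alpha.
    move/(signed_squares_scalar_sandwich hsig hs hdia hPsi').
    by move/(signed_squares_scalar_sandwich hsig hs hdia hPsi).
  move/(signed_squares_scalar_sandwich hsig hs hdia hPsi).
  by move/(signed_squares_scalar_sandwich hsig hs hdia hPsi').
move=> alpha.
have Z_c : Z alpha -> symm alpha /\ forall beta, sandwich alpha beta.
  move=> Za; split=> [|beta]; last exact: (signed_squares_sandwich hPsi).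
  by have [] := (signed_squares_scalar_sandwich hsig hs hdia hPsi alpha).1 Za.
have Z_b beta : Z alpha -> relations alpha beta.
  move=> /Z_c[symm_a sand]; split=> //.
  by have := sand (polyform1 V); rewrite /sandwich (geo1r hdia).
have b_Z beta : tr (dia alpha beta) != 0 -> relations alpha beta -> Z alpha.
  by move=> tr_neq0 [_ symm_a sand];
    apply: (sandwich_signed_squares hsig hs hdia hPsi tr_neq0).
split; last by move=> beta tr_neq0; split; [apply: Z_b | apply: b_Z].
  split; first exact: Z_c.
  move=> [symm_a sand].
  apply/(signed_squares_scalar_sandwich hsig hs hdia hPsi); split=> // beta.
  by exists (tr (dia alpha beta)); apply: sand.
move=> alpha_neq0; split=> [Za | [beta [tr_neq0 rel]]]; last exact: b_Z rel.
have [beta tr_neq0] := ex_trace_neq0 hPsi alpha_neq0 Za.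
by exists beta; split=> //; apply: Z_b.
Qed.
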